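(* Fix $k\geq 3$ and $a\in\mathbb{Z}^+$. Let $n\in\mathbb{Z}^+$ and let $I_1,I_2\subseteq[n]$ with $|I_1|=|I_2|=a$ be such that no two distinct elements of $I_1$ are at distance less than $\sqrt n$ from each other and no element of $I_1$ is at distance less than $\sqrt n$ from $1$ or from $n$, and similarly for $I_2$. Then \[\frac{d_k(I_1,n)}{d_k(I_2,n)}=1+O_{k,a}\left(n^{-1/6}\right).\]
   Context: $[n]=\{1,\dots,n\}$. For $w\in S_n$, $D_k(w)$ is the set of indices $i$ with $1\le i\le n-k+1$ and $w(i)>w(i+1)>\cdots>w(i+k-1)$. $d_k(I,n)$ is the number of $w\in S_n$ with $D_k(w)=I$. $O_{k,a}(g(n))$ denotes a quantity bounded in absolute value by $Kg(n)$ for all sufficiently large $n$, where $K$ (and the threshold) depends only on $k$ and $a$; in particular the bound is uniform over all admissible $I_1,I_2$ (the quotient is asserted to be defined for all sufficiently large $n$). *)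

(* Defs.v *)
From mathcomp Require Import all_boot all_order all_algebra all_fingroup.
From mathcomp Require Import all_classical all_reals all_analysis.

Set Implicit Arguments.
Unset Strict Implicit.
Unset Printing Implicit Defensive.

Import Order.TTheory GRing.Theory Num.Theory.
Local Open Scope ring_scope.

(* The element i : 'I_n stands for the index i.+1 of [n] = {1, ..., n}. *)
Definition pos (n : nat) (i : 'I_n) : nat := i.+1.

(* D_k(w). The condition pos i <= n - k + 1 (subtraction in Z) is written
   pos i + k <= n + 1. Only the order of the values of w matters, so they need
   no shift. *)
Definition kdesc_set (k n : nat) (w : 'S_n) : {set 'I_n} :=
  [set i : 'I_n | (pos i + k <= n + 1)%N &&
    [forall p : 'I_n, forall q : 'I_n,
      [&& pos i <= pos p, pos q == (pos p).+1 & pos q <= pos i + k - 1]%N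
        ==> (w q < w p)%N]].

(* d_k(I, n) *)
Definition kdesc_count (k n : nat) (I : {set 'I_n}) : nat :=
  #|[set w : 'S_n | kdesc_set k w == I]|.

Definition sqrt_far (R : realType) (n x y : nat) : Prop :=
  Num.sqrt (n%:R : R) <= `|x%:R - y%:R|.

Definition sqrt_separated (R : realType) (n : nat) (I : {set 'I_n}) : Prop :=
  (forall i j : 'I_n, i \in I -> j \in I -> i != j ->
     sqrt_far R n (pos i) (pos j)) /\
  (forall i : 'I_n, i \in I -> sqrt_far R n (pos i) 1 /\ sqrt_far R n (pos i) n).

(* Main.v *)
Require Import Defs.
From HB Require Import structures.
From mathcomp Require Import all_boot all_order all_algebra all_fingroup.
From mathcomp Require Import all_classical all_reals all_analysis.
From mathcomp Require Import polyrcf.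
From mathcomp Require Import ring lra zify.

Set Implicit Arguments.
Unset Strict Implicit.
Unset Printing Implicit Defensive.

Import Order.TTheory GRing.Theory Num.Theory.
Local Open Scope ring_scope.

(** Replace a uniform permutation by the relative order of independent uniform
    points of [0, 1] and read these points from left to right, recording the value
    of the current letter and the length of the decreasing run that it ends. As
    long as runs of length k are forbidden, the vector of densities of the current
    letter, indexed by the run length, evolves under a fixed positive linear
    operator T ([step]): an ascent integrates over [0, x], a descent over [x, 1].
    All densities are polynomials ([bern], [prim_bern], [coprim_bern]), so the
    integration is purely algebraic. A prescribed k-descent replaces two
    applications of T by another positive operator S ([insert_run]): the run is
    forced to reach length k and then to end. With a prescribed k-descents,
    d_k(I, n) / n! is therefore the total mass of
      T ^ g_a S T ^ g_(a-1) S ... S T ^ g_0 e,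
    where e is the initial vector ([state_density_step], [state_density_insert],
    [count_admissible], [kdesc_admissible]). The sum of the g_i depends on n, k and
    a only, and each g_i is at least the square root of n minus a constant.

    So it is enough that the mass barely depends on how this total time is
    distributed. A power of T with a fixed exponent maps every nonnegative vector
    between two multiples, in a bounded ratio C, of one and the same vector
    ([step_uniform]; this is where k >= 3 enters: for k = 2 the operator T is plain
    integration from 0, and no power of it has this property). By
    Birkhoff's argument T then contracts projectively
    ([ratio_interval_contract]), and after G steps every vector is a multiple of
    T ^ G e up to a factor q with q - 1 exponentially small in G ([iter_near]).
    Consequently S behaves like multiplication by one scalar, wherever it stands
    ([insertion_step]), and the mass is, up to q ^ (3 a), a quantity that is a
    function of n, k and a alone ([kdesc_count_near]). Taking the quotient for two
    sets I_1 and I_2 cancels this quantity and leaves q ^ (6 a), where G has the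
    order of the square root of n; then q - 1 = O(n ^ (-1/2)), more than
    required. *)

(** * Contraction of a positive operator on a cone *)

Section ConeContraction.

Variables (R : realFieldType) (V : lmodType R) (P : V -> Prop).
Hypothesis P0 : P 0.
Hypothesis PD : forall u v, P u -> P v -> P (u + v).
Hypothesis PZ : forall a u, 0 <= a -> P u -> P (a *: u).

Definition cone_le (u v : V) : Prop := P (v - u).

Definition cone_map (L : V -> V) : Prop := linear L /\ forall u, P u -> P (L u).

Definition cone_form (l : V -> R) : Prop :=
  (forall a u v, l (a *: u + v) = a * l u + l v) /\ forall u, P u -> 0 <= l u.

(** Multiplicative closeness: for q close to 1 this bounds the Hilbert
    projective distance and the normalisation at once. Positive maps
    preserve it, and in a chain of comparisons the factors multiply. *)
Definition cone_near (q : R) (u v : V) : Prop :=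
  cone_le u (q *: v) /\ cone_le v (q *: u).

Lemma cone_le_refl u : cone_le u u.
Proof. by rewrite /cone_le subrr. Qed.

Lemma cone_le_trans v u w : cone_le u v -> cone_le v w -> cone_le u w.
Proof. by move=> huv hvw; rewrite /cone_le -(subrKA v); apply: PD. Qed.

Lemma cone_leZ a u v : 0 <= a -> cone_le u v -> cone_le (a *: u) (a *: v).
Proof. by move=> a0 huv; rewrite /cone_le -scalerBr; apply: PZ. Qed.

Lemma cone_leZl a b u : a <= b -> P u -> cone_le (a *: u) (b *: u).
Proof. by move=> ab Pu; rewrite /cone_le -scalerBl; apply: PZ => //; rewrite subr_ge0. Qed.

Lemma linear_fun_scale (L : V -> V) a u : linear L -> L (a *: u) = a *: L u.
Proof.
move=> lin; have L0 : L 0 = 0.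
  by apply: (addrI (L 0)); have := lin 1 0 0; rewrite !scale1r !addr0 => <-.
by have := lin a u 0; rewrite L0 !addr0.
Qed.

Lemma linear_fun_sub (L : V -> V) u v : linear L -> L (u - v) = L u - L v.
Proof. by move=> lin; rewrite [u - v]addrC -scaleN1r lin scaleN1r addrC. Qed.

Lemma cone_map_le (L : V -> V) u v : cone_map L -> cone_le u v -> cone_le (L u) (L v).
Proof. by move=> [lin pos] huv; rewrite /cone_le -linear_fun_sub//; apply: pos. Qed.

Lemma cone_map_comp (L M : V -> V) : cone_map L -> cone_map M -> cone_map (L \o M).
Proof.
move=> [linL posL] [linM posM]; split; first by move=> a u v /=; rewrite linM linL.
by move=> u Pu /=; apply/posL/posM.
Qed.

Lemma cone_map_iter (L : V -> V) n : cone_map L -> cone_map (iter n L).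
Proof.
move=> cL; elim: n => [|n IH]; first by split.
exact: (@cone_map_comp L (iter n L)).
Qed.

Lemma cone_formZ (l : V -> R) a u : cone_form l -> l (a *: u) = a * l u.
Proof.
move=> [lin _]; have l0 : l 0 = 0.
  by apply: (addrI (l 0)); have := lin 1 0 0; rewrite scale1r !addr0 mul1r => <-.
by have := lin a u 0; rewrite l0 !addr0.
Qed.

Lemma cone_formB (l : V -> R) u v : cone_form l -> l (u - v) = l u - l v.
Proof. by move=> [lin _]; rewrite [u - v]addrC -scaleN1r lin mulN1r addrC. Qed.

Lemma cone_form_le (l : V -> R) u v : cone_form l -> cone_le u v -> l u <= l v.
Proof. by move=> cl huv; rewrite -subr_ge0 -cone_formB//; apply: cl.2. Qed.

Lemma cone_form_near (l : V -> R) q u v : cone_form l -> cone_near q u v ->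
  l u <= q * l v /\ l v <= q * l u.
Proof. by move=> cl [h1 h2]; rewrite -!cone_formZ//; split; apply: cone_form_le. Qed.

Lemma cone_near_sym q u v : cone_near q u v -> cone_near q v u.
Proof. by case. Qed.

Lemma cone_near_trans q r v u w : 0 <= q -> 0 <= r ->
  cone_near q u v -> cone_near r v w -> cone_near (q * r) u w.
Proof.
move=> q0 r0 [uv vu] [vw wv]; split.
  by apply: cone_le_trans uv _; rewrite -scalerA; apply: cone_leZ.
by apply: cone_le_trans wv _; rewrite mulrC -scalerA; apply: cone_leZ.
Qed.

Lemma cone_nearZ a q u v : 0 <= a -> cone_near q u v -> cone_near q (a *: u) (a *: v).
Proof.
by move=> a0 [uv vu]; split; rewrite scalerA mulrC -scalerA; apply: cone_leZ.
Qed.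

Lemma cone_near_map (L : V -> V) q u v : cone_map L ->
  cone_near q u v -> cone_near q (L u) (L v).
Proof.
by move=> cL [uv vu]; split; rewrite -linear_fun_scale; try exact: cL.1; apply: cone_map_le.
Qed.

Variables (T : V -> V) (p : nat) (C : R) (sigma : V -> R) (phi : V).
Hypothesis Tpos : cone_map T.
Hypothesis C1 : 1 <= C.
Hypothesis sigma_form : cone_form sigma.
Hypothesis TpE : forall f, P f ->
  cone_le (sigma f *: phi) (iter p T f) /\
  cone_le (iter p T f) ((C * sigma f) *: phi).

(** Birkhoff's contraction. If f lies between m h and M h, then f - m h and
    M h - f are in the cone, and the p-th power of T sends each of them above a
    multiple of phi, hence above a multiple of the image of h. Because sigma is
    linear, the two gains add up to exactly the fraction 1/C of M - m. *)
Lemma ratio_interval_contract f h m M : 0 < sigma h -> P h ->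
    cone_le (m *: h) f -> cone_le f (M *: h) ->
  exists m' M', [/\ m <= m', M' - m' = (1 - C^-1) * (M - m),
    cone_le (m' *: iter p T h) (iter p T f) &
    cone_le (iter p T f) (M' *: iter p T h)].
Proof.
move=> sh Ph mf fM; have C0 : 0 < C by apply: lt_le_trans C1.
have Tp := cone_map_iter p Tpos.
have key g : P g -> cone_le ((sigma g / (C * sigma h)) *: iter p T h) (iter p T g).
  move=> Pg; have [lo _] := TpE Pg; have [_ up] := TpE Ph.
  apply: cone_le_trans lo.
  have -> : sigma g *: phi = (sigma g / (C * sigma h)) *: ((C * sigma h) *: phi).
    by rewrite scalerA divfK// mulf_neq0 ?gt_eqF.
  apply: cone_leZ => //; apply: divr_ge0; first exact: sigma_form.2.
  by rewrite mulr_ge0 ?ltW.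
exists (m + sigma (f - m *: h) / (C * sigma h)), (M - sigma (M *: h - f) / (C * sigma h)).
split.
- rewrite lerDl divr_ge0 ?mulr_ge0 ?(ltW sh) ?(ltW C0)//.
  exact: sigma_form.2.
- rewrite !cone_formB// !cone_formZ//; field.
  by rewrite !gt_eqF.
- have := key _ mf; rewrite /cone_le (linear_fun_sub _ _ Tp.1) (linear_fun_scale _ _ Tp.1).
  by rewrite scalerDl opprD addrA.
- have := key _ fM; rewrite /cone_le (linear_fun_sub _ _ Tp.1) (linear_fun_scale _ _ Tp.1).
  by rewrite scalerBl addrAC.
Qed.

Variable e : V.
Hypothesis Pe : P e.
Hypothesis sigma_gt0 : forall n, 0 < sigma (iter n T e).

Lemma iter_in_cone n f : P f -> P (iter n T f).
Proof. exact: (cone_map_iter n Tpos).2. Qed.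

(** The first p steps bring any ratio into an interval [m, C ^ 2 m]; each of the
    next j blocks of p steps shrinks its length by 1 - 1/C. *)
Definition mixing_error (j : nat) : R := 1 + C ^+ 2 * (1 - C^-1) ^+ j.

Lemma iter_ratio_interval j f : P f ->
  exists m M, [/\ 0 <= m, M <= mixing_error j * m,
    cone_le (m *: iter (j.+1 * p)%N T e) (iter (j.+1 * p)%N T f) &
    cone_le (iter (j.+1 * p)%N T f) (M *: iter (j.+1 * p)%N T e)].
Proof.
move=> Pf; have C0 : 0 < C by apply: lt_le_trans C1.
have th0 : 0 <= 1 - C^-1 by rewrite subr_ge0 invf_le1.
pose m0 := sigma f / (C * sigma e).
have se : 0 < sigma e := sigma_gt0 0.
have m00 : 0 <= m0.
  by apply: divr_ge0; [exact: sigma_form.2 | rewrite mulr_ge0 ?ltW].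
suff [m [M [mm0 Mm lo up]]] : exists m M, [/\ m0 <= m,
    M - m = (1 - C^-1) ^+ j * (C ^+ 2 * m0 - m0),
    cone_le (m *: iter (j.+1 * p)%N T e) (iter (j.+1 * p)%N T f) &
    cone_le (iter (j.+1 * p)%N T f) (M *: iter (j.+1 * p)%N T e)].
  exists m, M; split => //; first exact: le_trans mm0.
  rewrite /mixing_error -[M](subrK m) Mm mulrDl mul1r addrC lerD2l.
  rewrite (_ : _ * m = (1 - C^-1) ^+ j * (C ^+ 2 * m)); last by rewrite mulrA [C ^+ 2 * _]mulrC.
  apply: ler_wpM2l; first exact: exprn_ge0.
  apply: le_trans (_ : C ^+ 2 * m0 <= _); first by rewrite gerBl.
  by apply: ler_wpM2l => //; apply: exprn_ge0; exact: ltW.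
elim: j => [|j [m [M [mm0 Mm lo up]]]].
  have [lof upf] := TpE Pf; have [loe upe] := TpE Pe.
  exists m0, (C ^+ 2 * m0); rewrite mul1n expr0 mul1r; split => //.
    apply: cone_le_trans lof.
    have -> : sigma f *: phi = m0 *: ((C * sigma e) *: phi).
      by rewrite scalerA divfK// mulf_neq0 ?gt_eqF.
    exact: cone_leZ.
  apply: cone_le_trans upf _.
  have -> : (C * sigma f) *: phi = (C ^+ 2 * m0) *: (sigma e *: phi).
    by rewrite scalerA; congr (_ *: _); rewrite /m0; field; apply/andP; split; rewrite gt_eqF.
  by apply: cone_leZ => //; rewrite mulr_ge0// exprn_ge0// ltW.
have [m' [M' [mm' Mm' lo' up']]] :=
  ratio_interval_contract (sigma_gt0 (j.+1 * p)%N) (iter_in_cone _ Pe) lo up.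
rewrite mulSn; exists m', M'; split; rewrite ?(iterD p (j.+1 * p)%N)//; first exact: le_trans mm'.
by rewrite Mm' Mm mulrA -exprS.
Qed.

Lemma mixing_error_ge1 j : 1 <= mixing_error j.
Proof.
rewrite lerDl mulr_ge0 ?sqr_ge0// exprn_ge0// subr_ge0 invf_le1//.
exact: lt_le_trans C1.
Qed.

Variable ell : V -> R.
Hypothesis ell_form : cone_form ell.
Variables (j G : nat).
Hypothesis jG : (j.+1 * p <= G)%N.
Hypothesis ell_gt0 : 0 < ell (iter G T e).

Let q := mixing_error j.
Let u := iter G T e.

(** An approximate left eigenfunctional of T: any number between the extreme
    ratios of the G-th iterates of f and e would do, and comparing their values
    under ell picks one, so that no limit has to be taken. *)
Definition growth_coef f := ell (iter G T f) / ell u.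

Lemma growth_coef_ge0 f : P f -> 0 <= growth_coef f.
Proof.
move=> Pf; apply: divr_ge0; last exact: ltW.
exact/ell_form.2/iter_in_cone.
Qed.

(** Iterating long enough forgets everything about f except one scalar. *)
Lemma iter_near f : P f -> cone_near q (iter G T f) (growth_coef f *: u).
Proof.
move=> Pf; have [m [M [m0 Mm lo up]]] := iter_ratio_interval j Pf.
have TG := cone_map_iter (G - j.+1 * p) Tpos.
have iterGE h : iter G T h = iter (G - j.+1 * p) T (iter (j.+1 * p)%N T h).
  by rewrite -iterD subnK.
have {}lo : cone_le (m *: u) (iter G T f).
  by have := cone_map_le TG lo; rewrite linear_fun_scale; [rewrite -!iterGE | exact: TG.1].
have {}up : cone_le (iter G T f) (M *: u).
  by have := cone_map_le TG up; rewrite linear_fun_scale; [rewrite -!iterGE | exact: TG.1].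
have Pu : P u by exact: iter_in_cone.
have mc : m <= growth_coef f.
  by rewrite ler_pdivlMr// -cone_formZ//; apply: cone_form_le.
have cM : growth_coef f <= M.
  by rewrite ler_pdivrMr// -cone_formZ//; apply: cone_form_le.
have q0 : 0 <= q by apply: le_trans (mixing_error_ge1 j).
split.
  apply: cone_le_trans up _; rewrite scalerA; apply: cone_leZl => //.
  by apply: le_trans Mm _; apply: ler_wpM2l.
apply: (@cone_le_trans (M *: u)); first exact: cone_leZl.
apply: (@cone_le_trans ((q * m) *: u)); first exact: cone_leZl.
by rewrite -scalerA; apply: cone_leZ.
Qed.

Variable S : V -> V.
Hypothesis Spos : cone_map S.
Let kappa := growth_coef (S u).

(** Why the location of an insertion does not matter. Write a for the
    coefficient of the N-th iterate of e, so that this iterate of u is near a u.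
    After S and G more steps, a u has become kappa a u up to a factor q, and a u
    can be turned back into the N-th iterate of u at the cost of another q. Thus
    S acts like the scalar kappa together with a loss of G steps of time, whatever
    N and t are. *)
Lemma insertion_step r i N t f : 0 <= r -> (G <= t)%N ->
    cone_near r f (kappa ^+ i *: iter N T u) ->
  cone_near (r * q ^+ 3) (iter t T (S f)) (kappa ^+ i.+1 *: iter (N + (t - G)) T u).
Proof.
move=> r0 Gt fN.
have q0 : 0 <= q by apply: le_trans (mixing_error_ge1 j).
have Pu : P u by exact: iter_in_cone.
have k0 : 0 <= kappa by apply/growth_coef_ge0/Spos.2.
have a0 : 0 <= growth_coef (iter N T e) by apply/growth_coef_ge0/iter_in_cone.
have Nu : cone_near q (iter N T u) (growth_coef (iter N T e) *: u).
  by rewrite /u -iterD addnC iterD; apply/iter_near/iter_in_cone.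
have TG := cone_map_iter G Tpos.
have TGS := cone_map_comp TG Spos.
have near1 := cone_near_trans r0 q0 fN (cone_nearZ (exprn_ge0 i k0) Nu).
have := cone_near_map TGS near1; rewrite !(linear_fun_scale _ _ TGS.1) /= => near2.
have near3 : cone_near q (iter G T (S u)) (kappa *: u) by apply/iter_near/Spos.2.
have near4 := cone_nearZ (exprn_ge0 i k0) (cone_nearZ a0 near3).
have near5 := cone_near_trans (mulr_ge0 r0 q0) q0 near2 near4.
have near6 : cone_near q (kappa ^+ i *: (growth_coef (iter N T e) *: (kappa *: u)))
    (kappa ^+ i.+1 *: iter N T u).
  rewrite [growth_coef _ *: _]scalerA [growth_coef _ * _]mulrC -scalerA scalerA -exprSr.
  by apply: cone_nearZ; [exact: exprn_ge0 | exact: cone_near_sym].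
have := cone_near_trans (mulr_ge0 (mulr_ge0 r0 q0) q0) q0 near5 near6.
move/(cone_near_map (cone_map_iter (t - G) Tpos)).
rewrite (linear_fun_scale _ _ (cone_map_iter (t - G) Tpos).1) -!iterD subnK// addnC.
have <- : r * q * q * q = r * q ^+ 3 by rewrite exprS expr2 !mulrA.
have <- : (G + (t - G + N) = N + (t - G) + G)%N by lia.
by [].
Qed.

End ConeContraction.

(** * Integration of polynomials on the unit interval *)

Section PolynomialIntegration.

Variable R : rcfType.
Implicit Types p q : {poly R}.

Definition prim p : {poly R} := \poly_(i < (size p).+1) (p`_i.-1 / i%:R).

(** The integral from x to 1, as a polynomial in x. *)
Definition coprim p : {poly R} := ((prim p).[1])%:P - prim p.

Lemma coef_prim p i : (prim p)`_i = p`_i.-1 / i%:R.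
Proof.
rewrite coef_poly; case: ltnP => // hi.
by rewrite [p`__]nth_default ?mul0r//; case: i hi.
Qed.

Lemma deriv_prim p : (prim p)^`() = p.
Proof.
apply/polyP => i; rewrite coef_deriv coef_prim /= -[LHS]mulr_natr divfK//.
Qed.

Lemma prim_is_linear : linear prim.
Proof.
move=> a p q; apply/polyP => i.
by rewrite coefD coefZ !coef_prim coefD coefZ mulrDl mulrA.
Qed.
HB.instance Definition _ :=
  GRing.isLinear.Build R {poly R} {poly R} *:%R prim prim_is_linear.

Lemma coprim_is_linear : linear coprim.
Proof.
move=> a p q; rewrite /coprim linearP hornerD hornerZ polyCD polyCM mul_polyC.
by rewrite scalerBr opprD addrACA.
Qed.
HB.instance Definition _ :=
  GRing.isLinear.Build R {poly R} {poly R} *:%R coprim coprim_is_linear.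

Lemma prim_at0 p : (prim p).[0] = 0.
Proof. by rewrite horner_coef0 coef_prim invr0 mulr0. Qed.

Lemma prim_unique p q : q^`() = p -> q.[0] = 0 -> q = prim p.
Proof.
move=> <- q0; apply/polyP => -[|i]; rewrite coef_prim.
  by rewrite invr0 mulr0 -horner_coef0.
by rewrite coef_deriv /= -[_ *+ i.+1]mulr_natr mulfK//.
Qed.

Lemma coprim_unique p q : q^`() = - p -> q.[1] = 0 -> q = coprim p.
Proof.
move=> dq q1; have : (q.[0])%:P - q = prim p.
  by apply: prim_unique; rewrite ?derivB ?derivC ?dq ?sub0r ?opprK// hornerD hornerN hornerC subrr.
move=> primE; rewrite /coprim -primE hornerD hornerN hornerC q1 subr0.
by rewrite opprB addrC subrK.
Qed.

Lemma primXn n : prim 'X^n = n.+1%:R^-1 *: 'X^(n.+1).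
Proof.
apply/esym/prim_unique; last by rewrite hornerZ hornerXn expr0n mulr0.
by rewrite derivZ derivXn -scaler_nat scalerA mulVf ?scale1r// pnatr_eq0.
Qed.

Lemma primC c : prim c%:P = c *: 'X.
Proof.
apply/esym/prim_unique; last by rewrite hornerZ hornerX mulr0.
by rewrite derivZ derivX alg_polyC.
Qed.

Lemma horner_coprim p x : (coprim p).[x] = (prim p).[1] - (prim p).[x].
Proof. by rewrite hornerD hornerN hornerC. Qed.

Lemma prim_le p (u v : R) : u <= v -> (forall x, u <= x <= v -> 0 <= p.[x]) ->
  (prim p).[u] <= (prim p).[v].
Proof.
rewrite le_eqVlt => /orP[/eqP->//|uv] p0; rewrite -subr_ge0.
have [c /andP[uc cv] ->] := poly_mvt (prim p) uv.
rewrite deriv_prim; apply: mulr_ge0; last by rewrite subr_ge0 ltW.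
by apply: p0; move: uc cv; rewrite !bnd_simp => /ltW -> /ltW ->.
Qed.

Lemma prim_lt p (u v : R) : u < v -> (forall x, u < x < v -> 0 < p.[x]) ->
  (prim p).[u] < (prim p).[v].
Proof.
move=> uv p0; rewrite -subr_gt0.
have [c /andP[uc cv] ->] := poly_mvt (prim p) uv.
rewrite deriv_prim; apply: mulr_gt0; last by rewrite subr_gt0.
by apply: p0; move: uc cv; rewrite !bnd_simp => -> ->.
Qed.

Definition nonneg01 p := forall x, 0 <= x <= 1 -> 0 <= p.[x].
Definition pos01 p := forall x, 0 < x < 1 -> 0 < p.[x].
Definition integral01 p : R := (prim p).[1].

Lemma nonneg01D p q : nonneg01 p -> nonneg01 q -> nonneg01 (p + q).
Proof. by move=> hp hq x hx; rewrite hornerD addr_ge0 ?hp ?hq. Qed.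

Lemma nonneg01Z a p : 0 <= a -> nonneg01 p -> nonneg01 (a *: p).
Proof. by move=> a0 hp x hx; rewrite hornerZ mulr_ge0 ?hp. Qed.

Lemma nonneg010 : nonneg01 0.
Proof. by move=> x _; rewrite horner0. Qed.

Lemma nonneg01_sum (I : Type) (r : seq I) (Q : pred I) (F : I -> {poly R}) :
  (forall i, Q i -> nonneg01 (F i)) -> nonneg01 (\sum_(i <- r | Q i) F i).
Proof. move=> h; elim/big_ind: _ => //; [exact: nonneg010 | exact: nonneg01D]. Qed.

Lemma nonneg01_prim p : nonneg01 p -> nonneg01 (prim p).
Proof.
move=> hp x /andP[x0 x1]; rewrite -(prim_at0 p); apply: prim_le => // y /andP[y0 yx].
by apply: hp; rewrite y0 (le_trans yx).
Qed.

Lemma nonneg01_coprim p : nonneg01 p -> nonneg01 (coprim p).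
Proof.
move=> hp x /andP[x0 x1]; rewrite horner_coprim subr_ge0.
by apply: prim_le => // y /andP[xy y1]; apply: hp; rewrite y1 (le_trans x0).
Qed.

Lemma integral01_ge0 p : nonneg01 p -> 0 <= integral01 p.
Proof. by move=> hp; apply: nonneg01_prim; rewrite // ler01 lexx. Qed.

Lemma prim_le_integral p x : nonneg01 p -> 0 <= x <= 1 -> (prim p).[x] <= integral01 p.
Proof. by move=> hp /(nonneg01_coprim hp); rewrite horner_coprim subr_ge0. Qed.

Lemma coprim_le_integral p x : nonneg01 p -> 0 <= x <= 1 -> (coprim p).[x] <= integral01 p.
Proof. by move=> hp /(nonneg01_prim hp); rewrite horner_coprim gerBl. Qed.

Lemma pos01_prim p : pos01 p -> pos01 (prim p).
Proof.
move=> hp x /andP[x0 x1]; rewrite -(prim_at0 p); apply: prim_lt => // y /andP[y0 yx].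
by apply: hp; rewrite y0 (lt_trans yx).
Qed.

Lemma pos01_coprim p : pos01 p -> pos01 (coprim p).
Proof.
move=> hp x /andP[x0 x1]; rewrite horner_coprim subr_gt0.
by apply: prim_lt => // y /andP[xy y1]; apply: hp; rewrite y1 (lt_trans x0).
Qed.

Lemma integral01_gt0 p : pos01 p -> 0 < integral01 p.
Proof. by move=> hp; rewrite -(prim_at0 p); apply: prim_lt. Qed.

(** The mean of a nonincreasing function over [0, x] is at least its mean over
    [0, 1]: p(x) bounds the first mean from below and the mean over [x, 1] from
    above. *)
Lemma prim_decreasing p : (forall x y, 0 <= x -> x <= y -> y <= 1 -> p.[y] <= p.[x]) ->
  nonneg01 (prim p - integral01 p *: 'X).
Proof.
move=> dp x /andP[x0 x1].
have lo : p.[x] * x <= (prim p).[x].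
  have := @prim_le (p - (p.[x])%:P) 0 x x0.
  rewrite linearB /= primC !hornerE prim_at0 ?(mulr0, oppr0, addr0, subr0) subr_ge0.
  by apply=> y /andP[y0 yx]; rewrite !hornerE subr_ge0 dp.
have up : (prim p).[1] - (prim p).[x] <= p.[x] * (1 - x).
  have := @prim_le ((p.[x])%:P - p) x 1 x1; rewrite linearB /= primC !hornerE.
  move=> h; suff : p.[x] * x - (prim p).[x] <= p.[x] - (prim p).[1] by lra.
  by apply: h => y /andP[y0 yx]; rewrite !hornerE subr_ge0 dp.
rewrite !hornerE /integral01; nra.
Qed.

Lemma coprim_increasing p : (forall x y, 0 <= x -> x <= y -> y <= 1 -> p.[x] <= p.[y]) ->
  nonneg01 (coprim p - integral01 p *: (1 - 'X)).
Proof.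
move=> ip x hx; have := @prim_decreasing (- p) _ x hx.
rewrite /integral01 linearN !hornerE /= => h.
suff: 0 <= - (prim p).[x] - - (prim p).[1] * x by lra.
by apply: h => u v u0 uv v1; rewrite !hornerE lerN2 ip.
Qed.

End PolynomialIntegration.

(** * The transfer operator of run lengths *)

Section RunLengthOperator.

Variables (R : rcfType) (d : nat).
Hypothesis d2 : (1 < d)%N.

Local Notation vec := (nat -> {poly R}).
Implicit Types f g : vec.

Definition vec_nonneg f : Prop := forall j, (j < d)%N -> nonneg01 (f j).

Definition vec_sum f : {poly R} := \sum_(i < d) f i.

Definition mass f : R := integral01 (vec_sum f).

(** With d = k - 1, component j of a vector is the density of the last letter of
    words that contain no decreasing run of length k and whose final decreasing
    run has length j + 1. Appending a larger letter starts a new run; appending a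
    smaller one lengthens the run, which is killed at length d + 1. *)
Definition step f : vec := fun j =>
  if j is i.+1 then (if (j < d)%N then coprim (f i) else 0) else prim (vec_sum f).

(** Two steps of time in which the run is forced to reach length d + 1 exactly:
    a descent from the longest run, then an ascent. *)
Definition insert_run f : vec := fun j =>
  if j is 0%N then prim (coprim (f d.-1)) else 0.

Definition start : vec := fun j => (j == 0%N)%:R.

(** Already the first two components, which exist as soon as k is at least 3,
    suffice for lower bounds. *)
Definition vec2 (p q : {poly R}) : vec := fun j =>
  if j is i.+1 then (if i is _.+1 then 0 else q) else p.

Lemma vec_sum_is_linear : linear vec_sum.
Proof.
move=> a f g; rewrite /vec_sum scaler_sumr -big_split /=.
by apply: eq_bigr => i _.
Qed.

Lemma step_is_linear : linear step.
Proof.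
move=> a f g; apply/funext => j; rewrite -[RHS]/(a *: step f j + step g j).
case: j => [|j] /=; first by rewrite vec_sum_is_linear linearP.
by case: ifP => _; rewrite ?linearP// scaler0 addr0.
Qed.

Lemma insert_run_is_linear : linear insert_run.
Proof.
move=> a f g; apply/funext => j.
rewrite -[RHS]/(a *: insert_run f j + insert_run g j).
case: j => [|j] /=; first by rewrite !linearP.
by rewrite scaler0 addr0.
Qed.

Lemma vec_nonneg0 : vec_nonneg 0.
Proof. by move=> j _; apply: nonneg010. Qed.

Lemma vec_nonnegD f g : vec_nonneg f -> vec_nonneg g -> vec_nonneg (f + g).
Proof. by move=> hf hg j jd; apply: nonneg01D; [apply: hf | apply: hg]. Qed.

Lemma vec_nonnegZ a f : 0 <= a -> vec_nonneg f -> vec_nonneg (a *: f).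
Proof. by move=> a0 hf j jd; apply: nonneg01Z => //; apply: hf. Qed.

Lemma vec_sum_nonneg f : vec_nonneg f -> nonneg01 (vec_sum f).
Proof. by move=> hf; apply: nonneg01_sum => i _; apply: hf. Qed.

Lemma step_cone : cone_map vec_nonneg step.
Proof.
split; first exact: step_is_linear.
move=> f hf [|j] jd /=; first exact/nonneg01_prim/vec_sum_nonneg.
by rewrite jd; apply/nonneg01_coprim/hf/ltnW.
Qed.

Lemma insert_run_cone : cone_map vec_nonneg insert_run.
Proof.
split; first exact: insert_run_is_linear.
move=> f hf [|j] jd /=; last exact: nonneg010.
by apply/nonneg01_prim/nonneg01_coprim/hf; rewrite prednK ?(ltnW d2).
Qed.

Lemma mass_form : cone_form vec_nonneg mass.
Proof.
split; last by move=> f hf; apply/integral01_ge0/vec_sum_nonneg.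
by move=> a f g; rewrite /mass vec_sum_is_linear /integral01 linearP hornerD hornerZ.
Qed.

Local Notation le := (cone_le vec_nonneg).

Lemma vec_leP f g : le f g <->
  forall j x, (j < d)%N -> 0 <= x <= 1 -> (f j).[x] <= (g j).[x].
Proof.
have E j x : ((g - f) j).[x] = (g j).[x] - (f j).[x] by rewrite hornerD hornerN.
split=> [h j x jd hx|h j jd x hx]; last by rewrite E subr_ge0 h.
by rewrite -subr_ge0 -E h.
Qed.

Let vle_refl := @cone_le_refl R _ _ vec_nonneg0.
Let vle_trans := @cone_le_trans R _ _ vec_nonnegD.
Let vleZ := @cone_leZ R _ _ vec_nonnegZ.
Let step_le f g := @cone_map_le R _ vec_nonneg _ f g step_cone.
Let iter_le n f g := @cone_map_le R _ vec_nonneg _ f g (cone_map_iter n step_cone).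
Let stepZ a f := linear_fun_scale a f step_is_linear.
Let iterZ n a f := linear_fun_scale a f (cone_map_iter n step_cone).1.

Lemma vec_sum_ge f i x : vec_nonneg f -> (i < d)%N -> 0 <= x <= 1 ->
  (f i).[x] <= (vec_sum f).[x].
Proof.
move=> hf id hx; rewrite /vec_sum (bigD1 (Ordinal id)) //= hornerD lerDl.
by apply: nonneg01_sum hx => j _; apply: hf.
Qed.

Lemma prim_monotone (p q : {poly R}) x :
  (forall y, 0 <= y <= 1 -> p.[y] <= q.[y]) -> 0 <= x <= 1 ->
  (prim p).[x] <= (prim q).[x].
Proof.
move=> pq hx; have := @nonneg01_prim _ (q - p) _ x hx.
rewrite linearB /= hornerD hornerN subr_ge0; apply => y hy.
by rewrite hornerD hornerN subr_ge0 pq.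
Qed.

Lemma coprim_monotone (p q : {poly R}) x :
  (forall y, 0 <= y <= 1 -> p.[y] <= q.[y]) -> 0 <= x <= 1 ->
  (coprim p).[x] <= (coprim q).[x].
Proof.
move=> pq hx; have := @nonneg01_coprim _ (q - p) _ x hx.
rewrite linearB /= hornerD hornerN subr_ge0; apply => y hy.
by rewrite hornerD hornerN subr_ge0 pq.
Qed.

Lemma vec2_nonneg p q : nonneg01 p -> nonneg01 q -> vec_nonneg (vec2 p q).
Proof. by move=> hp hq [|[|j]] _ //=; apply: nonneg010. Qed.

Lemma vec2_le p q p' q' :
  (forall x, 0 <= x <= 1 -> p.[x] <= p'.[x]) ->
  (forall x, 0 <= x <= 1 -> q.[x] <= q'.[x]) -> le (vec2 p q) (vec2 p' q').
Proof. by move=> hp hq; apply/vec_leP => -[|[|j]] x jd hx //=; [apply: hp | apply: hq]. Qed.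

Lemma vec_sum_vec2 p q : vec_sum (vec2 p q) = p + q.
Proof.
rewrite /vec_sum; case: d d2 => [|[|n]] // _.
by rewrite !big_ord_recl big1 ?addr0.
Qed.

Lemma vec2_le_step p q : nonneg01 q ->
  le (vec2 (prim (p + q)) (coprim p)) (step (vec2 p q)).
Proof.
move=> hq; apply/vec_leP => -[|[|j]] x jd hx /=; first by rewrite vec_sum_vec2.
  by rewrite jd.
rewrite jd horner0; case: j jd => [|j] _ /=; first exact: nonneg01_coprim.
by rewrite linear0 horner0.
Qed.

Let hE := (hornerD, hornerN, hornerZ, hornerXn, hornerX, hornerC, horner0).

(** The profile that the boundary conditions impose: a letter that ends an ascent
    is rarely near 0 and one that ends a descent is rarely near 1. *)
Definition ramp : vec := vec2 'X (1 - 'X).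

Lemma X_nonneg : nonneg01 ('X : {poly R}).
Proof. by move=> x /andP[x0 _]; rewrite hornerX. Qed.

Lemma oneBX_nonneg : nonneg01 (1 - 'X : {poly R}).
Proof. by move=> x /andP[_ x1]; rewrite !hE subr_ge0. Qed.

Lemma primX : prim 'X = 2%:R^-1 *: 'X^2 :> {poly R}.
Proof. by have := primXn R 1; rewrite expr1. Qed.

Lemma prim1 : prim 1 = 'X :> {poly R}.
Proof. by have := primXn R 0; rewrite expr0 expr1 invr1 scale1r. Qed.

Lemma coprim1 : coprim 1 = 1 - 'X :> {poly R}.
Proof. by rewrite /coprim prim1 hornerX. Qed.

Lemma vec2Z a p q : vec2 (a *: p) (a *: q) = a *: vec2 p q.
Proof.
apply/funext => j; rewrite -[RHS]/(a *: vec2 p q j).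
by case: j => [|[|j]] //=; rewrite scaler0.
Qed.

(** Up to a constant the profile reproduces itself, so lower bounds by it
    survive any number of steps. *)
Lemma ramp_le_step : le (2^-1 *: ramp) (step ramp).
Proof.
apply: vle_trans (vec2_le_step 'X oneBX_nonneg).
rewrite -vec2Z; apply: vec2_le => x /andP[x0 x1].
  by rewrite addrC subrK prim1 !hE; lra.
rewrite /coprim primX !hE; nra.
Qed.

Lemma ramp_le_iter n : le (2^-1 ^+ n *: ramp) (iter n step ramp).
Proof.
elim: n => [|n IH]; first by rewrite expr0 scale1r; apply: vle_refl.
apply: vle_trans (step_le IH); rewrite stepZ exprSr -scalerA.
by apply: vleZ; [apply: exprn_ge0; rewrite invr_ge0 | exact: ramp_le_step].
Qed.

(** Mass in the first component reaches both components after two steps: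
    descent then ascent for one, ascent then descent for the other. *)
Lemma rampL_iter2 : le (6^-1 *: ramp) (iter 2 step (vec2 'X 0)).
Proof.
have h1 := vec2_le_step 'X (nonneg010 (R := R)).
apply: vle_trans (step_le h1); apply: vle_trans (vec2_le_step _ _); last first.
  exact/nonneg01_coprim/X_nonneg.
rewrite -vec2Z addr0 /coprim primX; apply: vec2_le => x /andP[x0 x1].
  rewrite !(linearD, linearN, linearZ) /= primXn primC !hE; nra.
rewrite !(linearD, linearN, linearZ) /= primXn !hE; nra.
Qed.

Lemma rampR_step : le (2^-1 *: vec2 'X 0) (step (vec2 0 (1 - 'X))).
Proof.
apply: vle_trans (vec2_le_step _ oneBX_nonneg).
rewrite -vec2Z add0r linearB /= prim1 primX scaler0.
apply: vec2_le => x /andP[x0 x1]; last by rewrite linear0.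
by rewrite !hE; nra.
Qed.

(** Three steps are the common time at which mass starting in either of the two
    components has filled both. *)
Lemma rampL_iter3 : le (12^-1 *: ramp) (iter 3 step (vec2 'X 0)).
Proof.
apply: vle_trans (step_le rampL_iter2); rewrite stepZ.
apply: vle_trans (vleZ _ ramp_le_step); last by rewrite invr_ge0.
rewrite scalerA (_ : 6^-1 * 2^-1 = 12^-1); first exact: vle_refl.
by lra.
Qed.

Lemma rampR_iter3 : le (12^-1 *: ramp) (iter 3 step (vec2 0 (1 - 'X))).
Proof.
rewrite iterSr; apply: vle_trans (iter_le 2 rampR_step); rewrite iterZ.
apply: vle_trans (vleZ _ rampL_iter2); last by rewrite invr_ge0.
rewrite scalerA (_ : 2^-1 * 6^-1 = 12^-1); first exact: vle_refl.
by lra.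
Qed.


(** The constant vector dominates every bounded one, but exceeds multiples of
    the profile near the boundary; d further steps repair this. *)
Definition ones : vec := fun=> 1.

Lemma vec_sum_ones : vec_sum ones = d%:R%:P.
Proof. by rewrite /vec_sum sumr_const card_ord polyC_natr. Qed.

Lemma step_ones0 : step ones 0 = d%:R *: 'X.
Proof. by rewrite /= vec_sum_ones primC. Qed.

Lemma ones_iter_le n : le (iter n step ones) (d%:R ^+ n *: ones).
Proof.
elim: n => [|n IH]; first by rewrite expr0 scale1r; apply: vle_refl.
apply: vle_trans (step_le IH) _; rewrite stepZ exprSr -scalerA.
apply: vleZ; first by rewrite exprn_ge0.
apply/vec_leP => j x jd /andP[x0 x1].
have d1 : 1 <= d%:R :> R by rewrite ler1n ltnW.
case: j jd => [|j] jd; first by rewrite step_ones0 !hE; nra.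
by rewrite /= jd coprim1 !hE; nra.
Qed.

(** After one step the first component vanishes at 0 as the profile does. The
    comparison then moves up by one component at each step, since a descent
    applies the same monotone integral to both sides. *)
Lemma ones_le_ramp n j x : (j <= n.+1)%N -> (j < d)%N -> 0 <= x <= 1 ->
  (iter n.+1 step ones j).[x] <= (2 * d%:R) ^+ n.+1 * (iter n.+1 step ramp j).[x].
Proof.
have comp0 m y : 0 <= y <= 1 ->
    (iter m.+1 step ones 0).[y] <= (2 * d%:R) ^+ m.+1 * (iter m.+1 step ramp 0).[y].
  move=> hy; have d0 := ltnW d2.
  have := step_le (ones_iter_le m); rewrite stepZ => /vec_leP/(_ 0%N y d0 hy).
  rewrite -iterS => /le_trans; apply.
  have /vec_leP/(_ 0%N y d0 hy) := ramp_le_iter m.+1.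
  rewrite [(_ *: step ones) _]/(_ *: _) step_ones0 [(_ *: ramp) _]/(_ *: _) !hE => h.
  apply: le_trans (ler_wpM2l _ h); last by rewrite exprn_ge0// mulr_ge0.
  by rewrite exprMn mulrACA -exprMn divff ?expr1n ?mul1r// mulrA exprSr.
elim: n j x => [|n IH] [|j] x jn jd hx; try exact: comp0.
  case: j jn jd => // _ jd; rewrite expr1 /= jd coprim1.
  have : 2^-1 * (1 - x) <= (coprim ('X : {poly R})).[x].
    by rewrite /coprim primX !hE; case/andP: hx => x0 x1; nra.
  have d1 : 1 <= d%:R :> R by rewrite ler1n ltnW.
  by rewrite !hE; case/andP: hx => x0 x1 h; nra.
rewrite [iter _ _ _ _]/= [iter _ step ramp _]/= jd.
have := @coprim_monotone (iter n.+1 step ones j)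
  ((2 * d%:R) ^+ n.+1 *: iter n.+1 step ramp j) x.
rewrite linearZ hornerZ => h; apply: le_trans (h _ hx) _.
  by move=> y hy; rewrite hornerZ; apply: IH => //; apply: ltnW.
apply: ler_wpM2r.
  apply: nonneg01_coprim hx; apply: (cone_map_iter n.+1 step_cone).2 (ltnW jd).
  by apply: vec2_nonneg; [exact: X_nonneg | exact: oneBX_nonneg].
apply: ler_weXn2l; last exact: leqnSn.
have : 1 <= d%:R :> R by rewrite ler1n ltnW.
lra.
Qed.

Lemma mass_gt0 f : vec_nonneg f -> pos01 (f 0%N) -> 0 < mass f.
Proof.
move=> hf f0; apply: integral01_gt0 => x hx; apply: lt_le_trans (f0 x hx) _.
by apply: vec_sum_ge => //; [exact: ltnW | case/andP: hx => /ltW -> /ltW].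
Qed.

Lemma step_pos f : vec_nonneg f -> pos01 (f 0%N) -> pos01 (step f 0%N).
Proof.
move=> hf f0; apply: pos01_prim => x hx; apply: lt_le_trans (f0 x hx) _.
by apply: vec_sum_ge => //; [exact: ltnW | case/andP: hx => /ltW -> /ltW].
Qed.

Lemma iter_pos n f : vec_nonneg f -> pos01 (f 0%N) -> pos01 (iter n step f 0%N).
Proof.
move=> hf f0; elim: n => //= n IH; apply: step_pos => //.
exact: (cone_map_iter n step_cone).2.
Qed.

(** A run of length j + 1 needs j descents, hence j steps. *)
Lemma iter_pos_state n j f : vec_nonneg f -> pos01 (f 0%N) ->
  (j <= n)%N -> (j < d)%N -> pos01 (iter n step f j).
Proof.
move=> hf f0; elim: n j => [|n IH] [|j] // jn jd; first exact: iter_pos.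
by rewrite /= jd; apply/pos01_coprim/IH => //; apply: ltnW.
Qed.

Lemma start_nonneg : vec_nonneg start.
Proof.
move=> j _ x _; rewrite /start; case: (j == 0%N); rewrite ?horner0//.
by rewrite -[_%:R]/(1%:P) hornerC.
Qed.

Lemma start_pos : pos01 (start 0%N).
Proof. by move=> x _; rewrite -[start _]/(1%:P) hornerC. Qed.

(** One step makes the first component nondecreasing and all others
    nonincreasing, and a monotone density is controlled from the side where it is
    large by its total mass. So a second step is bounded below by the masses of
    these two groups, and above by their sum. *)
Lemma step_comp_bounds f x : vec_nonneg f -> 0 <= x <= 1 ->
  [/\ integral01 (step f 0) * (1 - x) <= (iter 2 step f 1).[x],
   (mass (step f) - integral01 (step f 0)) * x <= (iter 2 step f 0).[x]
   & forall j, (j < d)%N -> (iter 2 step f j).[x] <= mass (step f)].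
Proof.
move=> hf hx; have hg : vec_nonneg (step f) := step_cone.2 f hf.
have d0 := ltnW d2; split.
- rewrite [iter _ _ _ _]/= d2.
  have := @coprim_increasing _ (step f 0) _ x hx; rewrite !hE subr_ge0; apply.
  move=> u v u0 uv v1 /=; apply: prim_le => // y /andP[uy yv].
  by apply: vec_sum_nonneg; rewrite ?(le_trans u0)//= (le_trans yv).
- pose h := \sum_(i < d | (i : nat) != 0%N) step f i.
  have sumE : vec_sum (step f) = step f 0 + h.
    by rewrite /vec_sum (bigD1 (Ordinal d0)).
  have h0 : nonneg01 h by apply: nonneg01_sum => i _; apply: hg.
  rewrite /mass sumE /integral01 linearD hornerD addrC addKr.
  have hh : 0 <= (prim (step f 0)).[x] by apply/(nonneg01_prim _ hx)/hg.
  have := @prim_decreasing _ h _ x hx; rewrite !hE subr_ge0 => hd.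
  rewrite iterS [step _ _]/= sumE linearD hornerD.
  rewrite -[X in X <= _]add0r lerD//; apply: hd.
  move=> u v u0 uv v1; rewrite /h !horner_sum; apply: ler_sum => -[[|i] id] //= _.
  rewrite id !horner_coprim lerD2l lerN2; apply: prim_le => // y /andP[uy yv].
  by apply: hf; rewrite ?(le_trans u0) ?(le_trans yv)// ltnW.
- case=> [|j] jd; first exact/prim_le_integral/hx/vec_sum_nonneg.
  rewrite [iter _ _ _ _]/= jd; apply: le_trans (coprim_le_integral _ hx) _.
    exact/hg/ltnW.
  apply: prim_monotone; last by rewrite ler01 lexx.
  by move=> y hy; apply: vec_sum_ge => //; apply: ltnW.
Qed.

(** Uniform positivity. Two steps give upper bounds by a constant and lower
    bounds by the two halves of the profile, three more spread the lower bounds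
    over the whole profile, and the last d steps make the constant comparable to
    the profile. The size of the image is measured by mass (step f), which is
    linear in f. Plain mass would not do: vectors concentrated near 1 in the last
    component keep almost nothing after one step. *)
Lemma step_uniform f : vec_nonneg f ->
  le ((mass (step f) / 12) *: iter d step ramp) (iter (d + 5) step f) /\
  le (iter (d + 5) step f)
    ((12 * d%:R ^+ 3 * (2 * d%:R) ^+ d * (mass (step f) / 12)) *: iter d step ramp).
Proof.
move=> hf; pose s := mass (step f); pose a := integral01 (step f 0).
have hg : vec_nonneg (step f) := step_cone.2 f hf.
have d0 := ltnW d2.
have s0 : 0 <= s by apply: mass_form.2.
have a0 : 0 <= a by apply/integral01_ge0/hg.
have as_ : a <= s.
  apply: prim_monotone; last by rewrite ler01 lexx.
  by move=> y hy; apply: vec_sum_ge.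
have hL : vec_nonneg (vec2 'X 0) by apply: vec2_nonneg; [exact: X_nonneg | exact: nonneg010].
have hR : vec_nonneg (vec2 0 (1 - 'X)).
  by apply: vec2_nonneg; [exact: nonneg010 | exact: oneBX_nonneg].
split.
- (* a is the mass that arrives by an ascent, s - a the mass that arrives by a
     descent. *)
  have lo : le ((s - a) *: vec2 'X 0 + a *: vec2 0 (1 - 'X)) (iter 2 step f).
    apply/vec_leP => j x jd hx; have [b1 b0 _] := step_comp_bounds hf hx.
    rewrite -[(_ + _) j]/((s - a) *: vec2 'X 0 j + a *: vec2 0 (1 - 'X) j).
    case: j jd => [|[|j]] jd; rewrite [vec2 _ _ _]/= ?[vec2 0 _ _]/= ?scaler0 ?addr0 ?add0r.
    + by rewrite !hE.
    + by rewrite !hE.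
    + by rewrite horner0; apply: (cone_map_iter 2 step_cone).2.
  have lo5 : le ((s / 12) *: ramp) (iter 5 step f).
    rewrite -[5%N]/(3 + 2)%N iterD; apply: vle_trans (iter_le 3 lo).
    rewrite (cone_map_iter 3 step_cone).1 iterZ.
    have -> : (s / 12) *: ramp = ((s - a) *: (12^-1 *: ramp) + a *: (12^-1 *: ramp)).
      by rewrite !scalerA -scalerDl; congr (_ *: _); lra.
    apply: (@vle_trans ((s - a) *: iter 3 step (vec2 'X 0) + a *: (12^-1 *: ramp))).
      rewrite /cone_le opprD addrACA subrr addr0.
      by apply: vleZ; [rewrite subr_ge0 | exact: rampL_iter3].
    rewrite /cone_le opprD addrACA subrr add0r.
    by apply: vleZ => //; exact: rampR_iter3.
  by have := iter_le d lo5; rewrite iterZ -iterD.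
- have up : le (iter 2 step f) (s *: ones).
    apply/vec_leP => j x jd hx; have [_ _ up] := step_comp_bounds hf hx.
    rewrite -[(_ *: _) j]/(s *: 1%:P) !hE mulr1; exact: up.
  have up5 : le (iter 5 step f) ((s * d%:R ^+ 3) *: ones).
    rewrite -[5%N]/(3 + 2)%N iterD; apply: vle_trans (iter_le 3 up) _.
    by rewrite iterZ -scalerA; apply: vleZ => //; exact: ones_iter_le.
  rewrite iterD; apply: vle_trans (iter_le d up5) _; rewrite iterZ.
  apply: (@vle_trans ((s * d%:R ^+ 3) *: ((2 * d%:R) ^+ d *: iter d step ramp))).
    apply: vleZ; first by rewrite mulr_ge0// exprn_ge0.
    apply/vec_leP => j x jd hx; rewrite -[(_ *: _) j]/(_ *: iter d step ramp j) hornerZ.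
    by have := @ones_le_ramp d.-1 j x; rewrite prednK//; apply => //; apply: ltnW.
  rewrite scalerA (_ : _ * _ = 12 * d%:R ^+ 3 * (2 * d%:R) ^+ d * (s / 12)).
    exact: vle_refl.
  by field.
Qed.

End RunLengthOperator.

(** * Densities of the last letter *)

Section LastValueDensity.

Variable R : rcfType.

Definition divpow (p : {poly R}) n : {poly R} := n`!%:R^-1 *: p ^+ n.

Lemma divpow0 p : divpow p 0 = 1.
Proof. by rewrite /divpow fact0 invr1 scale1r expr0. Qed.

Lemma deriv_divpow p n : (divpow p n.+1)^`() = divpow p n * p^`().
Proof.
rewrite /divpow derivZ deriv_exp /= -[_ *+ n.+1]scaler_nat scalerA -scalerAl [p^`() * _]mulrC.
congr (_ *: _); rewrite factS natrM invfM mulrAC mulVf ?mul1r//.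
Qed.

Lemma horner_divpow p n x : (divpow p n).[x] = n`!%:R^-1 * p.[x] ^+ n.
Proof. by rewrite hornerZ horner_exp. Qed.

(** Density at x of the event that m + 1 independent uniform points are in a given
    relative order whose last one has rank r (counted from 0) and value x: of the
    m others, r lie below x and m - r above. *)
Definition bern m r : {poly R} :=
  if (r <= m)%N then divpow 'X r * divpow (1 - 'X) (m - r) else 0.

Lemma bern_gt m r : (m < r)%N -> bern m r = 0.
Proof. by rewrite /bern; case: leqP. Qed.

Lemma deriv_oneBX : (1 - 'X : {poly R})^`() = -1.
Proof. by rewrite derivB derivX -[1]/(1%:P) derivC sub0r. Qed.

Lemma deriv_bern0 m : (bern m.+1 0)^`() = - bern m 0.
Proof.
rewrite /bern !leq0n !subn0 !divpow0 !mul1r deriv_divpow deriv_oneBX.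
by rewrite mulrN1.
Qed.

Lemma deriv_bernS m r : (r <= m)%N -> (bern m.+1 r.+1)^`() = bern m r - bern m r.+1.
Proof.
move=> rm; rewrite /bern ltnS rm subSS derivM deriv_divpow derivX mulr1.
case: ltnP => [rm'|mr]; last first.
  have -> : r = m by apply/eqP; rewrite eqn_leq rm.
  by rewrite subnn divpow0 -[1]/(1%:P) derivC mulr0 addr0 subr0.
by rewrite -subnSK// deriv_divpow deriv_oneBX mulrN1 mulrN.
Qed.

Lemma bern_at0 m r : (bern m r.+1).[0] = 0.
Proof.
rewrite /bern; case: ifP => _; last by rewrite horner0.
by rewrite hornerM horner_divpow hornerX expr0n mulr0 mul0r.
Qed.

Lemma bern_at1 m r : (r <= m)%N -> (bern m.+1 r).[1] = 0.
Proof.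
move=> rm; rewrite /bern leqW// hornerM !horner_divpow !(hornerD, hornerN, hornerX, hornerC).
rewrite subrr subSn//.
by rewrite expr0n !mulr0.
Qed.

Lemma bernnn_at1 m : (bern m m).[1] = m`!%:R^-1.
Proof. by rewrite /bern leqnn subnn divpow0 mulr1 horner_divpow hornerX expr1n mulr1. Qed.

Lemma prim_bern_nat m r : (r <= m)%N ->
  \sum_(r.+1 <= i < m.+2) bern m.+1 i = prim (bern m r).
Proof.
move=> rm; apply: prim_unique; last first.
  by rewrite horner_sum big_add1 big1// => i _; apply: bern_at0.
rewrite raddf_sum big_add1 /=.
rewrite (eq_big_nat _ _ (F2 := fun i => - bern m i.+1 - - bern m i)).
  by rewrite telescope_sumr ?leqW// bern_gt// oppr0 sub0r opprK.
by move=> i /andP[_ im]; rewrite deriv_bernS// opprK addrC.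
Qed.

(** Inserting a new last letter above a last letter of rank r gives it any of the
    ranks r + 1, ..., m + 1: the integral over [0, x] of a density is the sum of
    the densities of these refined orders. *)
Lemma prim_bern m r : (r <= m)%N ->
  \sum_(i < m.+2 | (r < i)%N) bern m.+1 i = prim (bern m r).
Proof. by move=> rm; rewrite -prim_bern_nat// big_geq_mkord. Qed.

(** A new last letter below one of rank r takes one of the ranks 0, ..., r and
    pushes the old letter up. *)
Lemma coprim_bern m r : (r <= m)%N ->
  \sum_(i < m.+2 | (i <= r)%N) bern m.+1 i = coprim (bern m r).
Proof.
move=> rm; have := big_ord_widen m.+2 (bern m.+1) (leqW rm : (r.+1 <= m.+2)%N).
move=> <-.
apply: coprim_unique; last first.
  by rewrite horner_sum big1// => -[i] /= ir _; apply: bern_at1; apply: leq_trans rm.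
rewrite raddf_sum big_ord_recl /= deriv_bern0 -(big_mkord predT (fun i => (bern m.+1 i.+1)^`())).
rewrite (eq_big_nat _ _ (F2 := fun i => - bern m i.+1 - - bern m i)).
  by rewrite telescope_sumr// addrCA subrr addr0.
by move=> i /andP[_ ir]; rewrite deriv_bernS ?opprK 1?addrC// (leq_trans (ltnW ir)).
Qed.

Lemma integral_bern m r : (r <= m)%N -> integral01 (bern m r) = m.+1`!%:R^-1.
Proof.
move=> rm; rewrite /integral01 -prim_bern_nat// horner_sum big_nat_recr//=.
rewrite bernnn_at1 big_nat big1 ?add0r// => i /andP[_ im].
by rewrite bern_at1.
Qed.

End LastValueDensity.

(** * Permutations grown letter by letter *)

Section AppendLetter.

(** A permutation is its last value together with the pattern of the rest. *)
Lemma sum_perm_append (V : nmodType) m (F : 'S_m.+2 -> V) :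
  \sum_w F w = \sum_(w : 'S_m.+1) \sum_(r : 'I_m.+2) F (lift_perm ord_max r w).
Proof.
rewrite exchange_big /= (partition_big (fun s : 'S_m.+2 => s ord_max) predT) //=.
apply: eq_bigr => r _; rewrite (reindex (lift_perm ord_max r)); last first.
  pose down (i : 'I_m.+2) (s : 'S_m.+2) k := odflt k (unlift (s i) (s (lift i k))).
  have downK i (s : 'S_m.+2) k : lift (s i) (down i s k) = s (lift i k).
    rewrite /down; have := neq_lift i k.
    by rewrite -(can_eq (permK s)) => /unlift_some[] ? ? ->.
  have down_inj s : injective (down ord_max s).
    apply: can_inj (down (s ord_max) s^-1%g) _ => k'.
    by rewrite {1}/down downK !permK liftK.
  exists (fun s => perm (down_inj s)) => [s _ | s].
    by apply/permP=> k'; rewrite permE /down lift_perm_lift lift_perm_id liftK.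
  move/(s _ =P _) => sr; apply/permP=> k.
  case: (unliftP ord_max k) => [k'|] ->; rewrite ?lift_perm_id //.
  by rewrite lift_perm_lift -sr permE downK.
by apply: eq_bigl => s; rewrite lift_perm_id eqxx.
Qed.

Definition descent m (w : 'S_m.+1) (t : nat) : bool := (w (inord t.+1) < w (inord t))%N.

Lemma inord_lift_max m t : (t <= m)%N ->
  inord t = lift ord_max (inord t : 'I_m.+1) :> 'I_m.+2.
Proof.
move=> tm; apply: val_inj; rewrite /= !inordK ?ltnS ?leqW// /bump.
by rewrite leqNgt ltnS tm.
Qed.

Lemma descent_append m (w : 'S_m.+1) r t : (t < m)%N ->
  descent (lift_perm ord_max r w) t = descent w t.
Proof.
move=> tm; rewrite /descent !inord_lift_max//; last exact: ltnW.
by rewrite !lift_perm_lift ltnNge leq_bump2 -ltnNge.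
Qed.

Lemma descent_append_last m (w : 'S_m.+1) r :
  descent (lift_perm ord_max r w) m = (r <= w ord_max)%N.
Proof.
rewrite /descent (inord_lift_max (leqnn m)).
have -> : inord m.+1 = ord_max :> 'I_m.+2 by apply: val_inj; rewrite /= inordK.
have -> : inord m = ord_max :> 'I_m.+1 by apply: val_inj; rewrite /= inordK.
rewrite lift_perm_id lift_perm_lift /= /bump; case: leqP => h; lia.
Qed.

(** Length of the decreasing run that ends at position t (counted from 0), when
    sigma marks the positions followed by a descent. *)
Fixpoint run (sigma : nat -> bool) t : nat :=
  if t is t'.+1 then (if sigma t' then (run sigma t').+1 else 1) else 1.

(** The positions at which the current run has length at least k are exactly
    those marked by b. Stating the condition at the end of a run makes it local
    in time. *)
Fixpoint admissible k (b sigma : nat -> bool) m : bool :=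
  (if m is m'.+1 then admissible k b sigma m' else true) && ((k <= run sigma m)%N == b m).

Lemma run_gt0 sigma t : (0 < run sigma t)%N.
Proof. by case: t => //= t; case: ifP. Qed.

Lemma eq_run sigma tau t : (forall u, (u < t)%N -> sigma u = tau u) ->
  run sigma t = run tau t.
Proof.
elim: t => //= t IH e; rewrite e// IH// => u ut; apply: e; exact: leqW.
Qed.

Lemma eq_admissible k b sigma tau m : (forall u, (u < m)%N -> sigma u = tau u) ->
  admissible k b sigma m = admissible k b tau m.
Proof.
elim: m => //= m IH e; rewrite e// IH ?(@eq_run sigma tau m)// => u um; apply: e; exact: leqW.
Qed.

Lemma leq_runP k (sigma : nat -> bool) t : (0 < k)%N ->
  reflect ((k <= t.+1)%N /\ forall u, (t.+1 - k <= u < t)%N -> sigma u) (k <= run sigma t)%N.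
Proof.
elim: t k => [|t IH] [|k] // _.
  rewrite /=; apply: (iffP idP) => [k1|[]//]; split=> // u; lia.
rewrite /=; case: ifP => st.
  case: k => [|k]; first by rewrite ltnS leq0n; constructor; split=> // u; lia.
  rewrite ltnS; apply: (iffP (IH k.+1 isT)) => -[h1 h2]; split => //.
    move=> u; rewrite subSS => /andP[h3 h4]; have [->//|ut] := eqVneq u t.
    by apply: h2; rewrite h3 ltn_neqAle ut.
  by move=> u /andP[h3 h4]; apply: h2; rewrite subSS h3 leqW.
case: k => [|k]; first by constructor; split=> // u; lia.
constructor => -[h1 /(_ t)]; rewrite st; apply/implyP; lia.
Qed.

Variable R : rcfType.

Definition state_density k b m j : {poly R} :=
  \sum_(w : 'S_m.+1 | admissible k b (descent w) m && (run (descent w) m == j.+1))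
     bern R m (w ord_max).

Definition total_density k b m : {poly R} :=
  \sum_(w : 'S_m.+1 | admissible k b (descent w) m) bern R m (w ord_max).

Lemma admissible_append k b m (w : 'S_m.+1) r :
  admissible k b (descent (lift_perm ord_max r w)) m.+1 =
  admissible k b (descent w) m &&
  ((k <= if (r <= w ord_max)%N then (run (descent w) m).+1 else 1)%N == b m.+1).
Proof.
rewrite /= descent_append_last; congr (_ && _).
  by apply: eq_admissible => u um; apply: descent_append.
by rewrite (@eq_run _ (descent w)) // => u um; apply: descent_append.
Qed.

Lemma run_append m (w : 'S_m.+1) r :
  run (descent (lift_perm ord_max r w)) m.+1 =
  if (r <= w ord_max)%N then (run (descent w) m).+1 else 1%N.
Proof.
rewrite /= descent_append_last.
by rewrite (@eq_run _ (descent w)) // => u um; apply: descent_append.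
Qed.

Lemma last_le m (w : 'S_m.+1) : (w ord_max <= m)%N.
Proof. by rewrite -ltnS. Qed.

Lemma state_density_succ k b m i : state_density k b m.+1 i.+1 =
  if (k <= i.+2)%N == b m.+1 then coprim (state_density k b m i) else 0.
Proof.
rewrite /state_density big_mkcond sum_perm_append.
transitivity (\sum_(w : 'S_m.+1) if ((k <= i.+2)%N == b m.+1) &&
    (admissible k b (descent w) m && (run (descent w) m == i.+1))
  then coprim (bern R m (w ord_max)) else 0).
  apply: eq_bigr => w _; rewrite -(coprim_bern R (last_le w)) -big_mkcond.
  case: ifP => [/and3P[kb okw /eqP rw]|h].
    apply: eq_big => r; last by rewrite lift_perm_id.
    rewrite admissible_append run_append okw rw.
    by case: ifP => _; rewrite ?kb ?eqxx // andbF.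
  apply: big1 => r; rewrite admissible_append run_append.
  case: ifP => _; last by rewrite andbF.
  case/andP => /andP[okw kb] /eqP[rw]; move: h.
  by rewrite okw rw eqxx andbT -rw kb.
rewrite -big_mkcond; case: ifP => _ /=; last exact: big_pred0_eq.
by rewrite raddf_sum.
Qed.

Lemma state_density_zero k b m : state_density k b m.+1 0 =
  if (k <= 1)%N == b m.+1 then prim (total_density k b m) else 0.
Proof.
rewrite /state_density /total_density big_mkcond sum_perm_append.
transitivity (\sum_(w : 'S_m.+1) if ((k <= 1)%N == b m.+1) &&
    admissible k b (descent w) m then prim (bern R m (w ord_max)) else 0).
  apply: eq_bigr => w _; rewrite -(prim_bern R (last_le w)) -big_mkcond.
  case: ifP => [/andP[kb okw]|h].
    apply: eq_big => r; last by rewrite lift_perm_id.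
    rewrite admissible_append run_append okw ltnNge.
    by case: ifP => _; rewrite ?kb ?eqxx//= eqSS eqn0Ngt run_gt0 andbF.
  apply: big1 => r; rewrite admissible_append run_append.
  case: ifP => _; first by rewrite eqSS eqn0Ngt run_gt0 andbF.
  by case/andP => /andP[okw kb] _; move: h; rewrite okw kb.
rewrite -big_mkcond; case: ifP => _ /=; last exact: big_pred0_eq.
by rewrite raddf_sum.
Qed.

Lemma state_density_start k b : (1 < k)%N -> b 0%N = false ->
  state_density k b 0 = start R.
Proof.
move=> k1 b0; apply/funext => j; rewrite /state_density /start /=.
rewrite b0 leqNgt k1 /=; case: j => [|j] /=; last by rewrite big_pred0_eq.
rewrite (eq_bigr (fun=> 1)) => [|w _]; first by rewrite sumr_const card_Sn.
by rewrite ord1 /bern leqnn subnn !divpow0 mulr1.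
Qed.

Lemma admissible_run k b sigma m : admissible k b sigma m -> (k <= run sigma m)%N = b m.
Proof. by case: m => [|m] /= => [|/andP[_]] /eqP. Qed.

(** At an unmarked time all runs have length at most d, so the first d
    components carry everything. *)
Lemma total_density_state d b m : b m = false ->
  total_density d.+1 b m = vec_sum d (state_density d.+1 b m).
Proof.
move=> bm; rewrite /vec_sum /state_density.
rewrite (exchange_big_dep (fun w : 'S_m.+1 => admissible d.+1 b (descent w) m)) /= => [|j w _ /andP[]//].
apply: eq_bigr => w /[dup] /admissible_run; rewrite bm ltnNge => /negbFE rd okw.
have rp : ((run (descent w) m).-1 < d)%N by rewrite prednK ?run_gt0.
rewrite (big_pred1 (Ordinal rp))// => j; rewrite okw /=.
by rewrite -{1}(prednK (run_gt0 (descent w) m)) eqSS eq_sym.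
Qed.

Lemma state_density_step d b m : (1 < d)%N -> b m = false -> b m.+1 = false ->
  state_density d.+1 b m.+1 = step d (state_density d.+1 b m).
Proof.
move=> d2 bm bm1; apply/funext => -[|i] /=.
  by rewrite state_density_zero bm1 ltnS leqNgt (ltnW d2) total_density_state.
by rewrite state_density_succ bm1 eqbF_neg -ltnNge ltnS.
Qed.

(** A marked time between two unmarked ones: the run must jump from length d to
    d + 1 and be broken immediately after. *)
Lemma state_density_insert d b m : (1 < d)%N ->
  b m = false -> b m.+1 = true -> b m.+2 = false ->
  state_density d.+1 b m.+2 = insert_run d (state_density d.+1 b m).
Proof.
move=> d2 bm bm1 bm2.
have low i : (i < d)%N -> state_density d.+1 b m.+1 i = 0.
  case: i => [|i] id; first by rewrite state_density_zero bm1 ltnS leqNgt (ltnW d2).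
  by rewrite state_density_succ bm1 ltnS leqNgt id.
apply/funext => -[|i] /=; last first.
  by rewrite state_density_succ bm2; case: ltnP => //= id; rewrite low ?linear0//; lia.
rewrite state_density_zero bm2 ltnS leqNgt (ltnW d2) /=; congr prim.
have -> : total_density d.+1 b m.+1 = state_density d.+1 b m.+1 d.
  rewrite /total_density /state_density [LHS]big_mkcond [RHS]big_mkcond.
  rewrite [LHS]sum_perm_append [RHS]sum_perm_append.
  apply: eq_bigr => w _; apply: eq_bigr => r _.
  rewrite run_append admissible_append; case: (boolP (admissible _ _ _ m)) => [okw|_]; last by [].
  rewrite !andTb.
  have := admissible_run okw; rewrite bm ltnNge => /negbFE rd.
  rewrite bm1 eqb_id; case: (r <= w ord_max)%N.
    by rewrite eqSS ltnS eqn_leq rd; case: (d <= _)%N.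
  by rewrite ltnS leqNgt (ltnW d2).
by rewrite -[d in state_density _ _ _ d](prednK (ltnW d2)) state_density_succ prednK ?(ltnW d2)// bm1 leqnn.
Qed.

(** All orders of m + 1 uniform points have probability 1 / (m + 1)!. *)
Lemma count_admissible d b m : b m = false ->
  #|[set w : 'S_m.+1 | admissible d.+1 b (descent w) m]|%:R =
  m.+1`!%:R * mass d (state_density d.+1 b m) :> R.
Proof.
move=> bm; rewrite /mass -total_density_state// /integral01 linear_sum horner_sum.
under eq_bigr => w _ do rewrite -[(prim _).[1]]/(integral01 _) (integral_bern R (last_le w)).
rewrite sumr_const mulrnAr divff ?cardsE// pnatr_eq0 -lt0n fact_gt0.
Qed.

End AppendLetter.

(** A run of length k that starts at i is complete at position i + k - 1. *)
Definition forced_times n k (I : {set 'I_n}) (t : nat) : bool :=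
  [exists i in I, (i + k.-1 == t)%N].

Lemma kdesc_mem k m (w : 'S_m.+1) (i : 'I_m.+1) : (0 < k)%N ->
  (i \in kdesc_set k w) = ((i + k <= m.+1)%N && (k <= run (descent w) (i + k.-1))%N).
Proof.
move=> k0; rewrite inE /pos addSn addn1 ltnS; case: (boolP (i + k <= m.+1)%N) => //= ik.
apply/idP/leq_runP => //.
  move=> /forallP h; split; first by lia.
  move=> u hu; have [u1 u2] : (u < m.+1 /\ u.+1 < m.+1)%N by lia.
  have /forallP/(_ (inord u.+1)) := h (inord u).
  rewrite !inordK// eqxx /= => /implyP; apply; lia.
case=> _ h; apply/forallP => p; apply/forallP => q; apply/implyP => /and3P[h1 /eqP h2 h3].
have : descent w p by apply: h; lia.
rewrite /descent (_ : p.+1 = q :> nat); last by lia.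
by rewrite !inord_val.
Qed.

(** The bound on I matters: an element of I too close to the end could never be
    a k-descent, although no position would record it. *)
Lemma kdesc_admissible k m (I : {set 'I_m.+1}) (w : 'S_m.+1) : (0 < k)%N ->
  (forall i, i \in I -> (i + k <= m.+1)%N) ->
  (kdesc_set k w == I) = admissible k (forced_times k I) (descent w) m.
Proof.
move=> k0 hI.
have admP b sigma n : reflect (forall t, (t <= n)%N -> (k <= run sigma t)%N = b t)
    (admissible k b sigma n).
  elim: n => [|n IH] /=.
    by apply: (iffP eqP) => [h [|t]//|h]; apply: (h 0%N).
  apply: (iffP andP) => [[/IH h /eqP h'] t|h].
    by rewrite leq_eqVlt => /orP[/eqP->//|]; apply: h.
  by split; [apply/IH => t tn; apply: h; exact: leqW | apply/eqP/(h n.+1)].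
apply/eqP/admP => [<- t tm|h].
  case: (leqP k t.+1) => tk.
    have io : (t.+1 - k < m.+1)%N by lia.
    have E := kdesc_mem w (Ordinal io) k0.
    have e1 : (t.+1 - k + k.-1 = t)%N by lia.
    have e2 : (t.+1 - k + k <= m.+1)%N by lia.
    rewrite /= e1 e2 /= in E; rewrite -E; apply/idP/existsP => [hi|[j /andP[hj /eqP ej]]].
      by exists (Ordinal io); rewrite hi /= e1.
    by rewrite (_ : Ordinal io = j)//; apply: val_inj => /=; lia.
  apply/idP/existsP => [/(leq_runP _ _ k0)[]|[j /andP[_ /eqP]]]; lia.
apply/setP => i; rewrite kdesc_mem//; case: (boolP (i + k <= m.+1)%N) => /= ik.
  rewrite h; last by lia.
  apply/existsP/idP => [[j /andP[hj /eqP ej]]|hi]; last by exists i; rewrite hi /=.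
  by rewrite (_ : i = j)//; apply: val_inj => /=; lia.
by apply/esym/negP => /hI; apply/negP.
Qed.

(** * The number of permutations with prescribed, well-spaced k-descents *)

Section InsertedRuns.

Variables (R : rcfType) (d : nat).
Hypothesis d2 : (1 < d)%N.

(** The ratio of the upper and lower constants of step_uniform. *)
Definition step_distortion : R := 12 * d%:R ^+ 3 * (2 * d%:R) ^+ d.

Lemma step_distortion_ge1 : 1 <= step_distortion.
Proof.
have d1 : 1 <= d%:R :> R by rewrite ler1n ltnW.
rewrite /step_distortion.
have h1 : 1 <= d%:R ^+ 3 :> R by apply: exprn_ege1.
have h2 : 1 <= (2 * d%:R) ^+ d :> R by apply: exprn_ege1; lra.
nra.
Qed.

Variables (j G : nat).
Hypothesis jG : (j.+1 * (d + 5) <= G)%N.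

Let q : R := mixing_error step_distortion j.
Let u := iter G (step d) (start R).
Let e0 : vec_nonneg d (start R) := @start_nonneg R d.

(** The scalar by which one prescribed run multiplies the mass. *)
Definition insertion_factor : R :=
  growth_coef (step d) (start R) (mass d) G (insert_run d u).

Lemma mass_iter_start_gt0 n : 0 < mass d (iter n (step d) (start R)).
Proof.
apply: mass_gt0 => //; first exact: (cone_map_iter n (step_cone R d)).2.
by apply: iter_pos => //; exact: start_pos.
Qed.

(** An insertion acts on runs of length d, which appear only after d - 1 steps;
    G is larger than that. *)
Lemma insertion_factor_gt0 : 0 < insertion_factor.
Proof.
apply: divr_gt0; last exact: mass_iter_start_gt0.
have Pu : vec_nonneg d u by apply: (cone_map_iter G (step_cone R d)).2.
have Pi : vec_nonneg d (insert_run d u) := (insert_run_cone R d2).2 _ Pu.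
apply: mass_gt0 => //; first exact: (cone_map_iter G (step_cone R d)).2.
apply: iter_pos => //; apply/pos01_prim/pos01_coprim.
apply: iter_pos_state => //; first exact: start_pos.
  by move: jG; rewrite mulSn; lia.
by rewrite prednK ?(ltnW d2).
Qed.

Definition scaled_mass f : R := mass d (step d f) / 12.

Lemma scaled_mass_form : cone_form (vec_nonneg d) scaled_mass.
Proof.
split=> [a f g|f hf]; rewrite /scaled_mass.
  by rewrite (step_is_linear d) (mass_form R d).1 mulrDl mulrA.
by apply: divr_ge0 => //; apply/(mass_form R d).2/(step_cone R d).2.
Qed.

Lemma insert_near r i N t f : 0 <= r -> (G <= t)%N ->
  cone_near (vec_nonneg d) r f (insertion_factor ^+ i *: iter N (step d) u) ->
  cone_near (vec_nonneg d) (r * q ^+ 3) (iter t (step d) (insert_run d f))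
    (insertion_factor ^+ i.+1 *: iter (N + (t - G)) (step d) u).
Proof.
apply: (@insertion_step R _ (vec_nonneg d) (@vec_nonnegD R d) (@vec_nonnegZ R d)
  (step d) (d + 5)%N step_distortion scaled_mass (iter d (step d) (ramp R))
  (step_cone R d) step_distortion_ge1 scaled_mass_form (@step_uniform R d d2)
  (start R) e0 _ (mass d) (mass_form R d) j G jG (mass_iter_start_gt0 G)
  (insert_run d) (insert_run_cone R d2)).
by move=> n; apply: divr_gt0 => //; rewrite -iterS; apply: mass_iter_start_gt0.
Qed.

(** Marked times are listed from the last to the first. Between two of them lie
    the two steps of an insertion and at least G steps of mixing. *)
Definition spaced (x y : nat) : bool := (y + G.+2 <= x)%N.

Lemma spaced_trans : transitive spaced.
Proof. by move=> y x z; rewrite /spaced; lia. Qed.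

Lemma state_density_iter b t m : (forall s, (t <= s <= t + m)%N -> b s = false) ->
  state_density R d.+1 b (t + m) = iter m (step d) (state_density R d.+1 b t).
Proof.
elim: m => [|m IH] hb; first by rewrite addn0.
rewrite addnS state_density_step//; try by apply: hb; lia.
by rewrite IH// => s hs; apply: hb; lia.
Qed.

Lemma spaced_room s t : (G <= t)%N -> all (ltn G) s -> path spaced t.+1 s ->
  (size s * G.+2 + G <= t)%N.
Proof.
elim: s t => [|x s IH] t Gt //= /andP[Gx hs] /andP[hx hp].
have x0 : (x.-1.+1 = x)%N by apply: prednK; apply: leq_ltn_trans Gx.
have /(_ _ hs) := IH x.-1; rewrite x0 => /(_ _ hp).
by move: hx Gx; rewrite /spaced mulSn /= => h1 h2 h3; have := h3 ltac:(lia); lia.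
Qed.

(** Each marked time costs G + 2 units of time, a factor insertion_factor and a
    relative error q ^ 3. The right-hand side depends on the marked times only
    through their number. *)
Lemma state_density_near b s t : (G <= t)%N ->
    (forall x, (x <= t)%N -> b x = (x \in s)) ->
    all (ltn G) s -> path spaced t.+1 s ->
  cone_near (vec_nonneg d) (q ^+ (3 * size s)) (state_density R d.+1 b t)
    (insertion_factor ^+ size s *: iter (t - size s * G.+2 - G) (step d) u).
Proof.
elim: s t => [|x s IH] t Gt hb.
  move=> _ _; rewrite !expr0 scale1r subn0 -iterD subnK//.
  rewrite -[t in state_density _ _ _ t]add0n state_density_iter; last by move=> s /= st; apply: hb.
  rewrite state_density_start ?hb//; last exact: ltnW.
  by split; rewrite scale1r; apply: cone_le_refl; exact: vec_nonneg0.
move=> /= /andP[Gx hs] /andP[xt hp].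
have [y xE] : exists y, x = y.+1 by exists x.-1; rewrite prednK//; apply: leq_ltn_trans Gx.
subst x.
have room := spaced_room (Gx : (G <= y)%N) hs hp.
have hlt z : z \in s -> (z + G.+2 <= y.+1)%N.
  by move: hp; rewrite (path_sortedE spaced_trans) => /andP[/allP h _] /h.
have hby z : (z <= y)%N -> b z = (z \in s).
  move=> zy; rewrite hb; last by move: xt; rewrite /spaced; lia.
  by rewrite inE; case: eqP => // zE; lia.
have near := IH y Gx hby hs hp.
move: xt; rewrite /spaced => xt.
have far z : (y < z)%N -> z \in s = false by move=> yz; apply/negP => /hlt; lia.
have tE : t = (y.+2 + (t - y.+2))%N by lia.
rewrite [in state_density _ _ _ _]tE state_density_iter; last first.
  by move=> z hz; rewrite hb ?inE ?far//; lia.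
rewrite state_density_insert//; last 3 first.
- by rewrite hby//; apply/negP => /hlt; lia.
- by rewrite hb ?mem_head//; lia.
- by rewrite hb ?inE ?far//; lia.
have q0 : 0 <= q by apply: le_trans (mixing_error_ge1 step_distortion_ge1 j).
have -> : q ^+ (3 * (size s).+1) = q ^+ (3 * size s) * q ^+ 3 by rewrite -exprD mulnS addnC.
have <- : (y - size s * G.+2 - G + (t - y.+2 - G) = t - (size s).+1 * G.+2 - G)%N.
  rewrite [((size s).+1 * _)%N]mulSn; move: (size s * G.+2)%N room => A room; lia.
by apply: insert_near => //; [exact: exprn_ge0 | lia].
Qed.

(** The common main term for all sets of a well-spaced indices. *)
Definition reference_mass a m : R :=
  insertion_factor ^+ a * mass d (iter (m - a * G.+2 - G) (step d) u).

Lemma reference_mass_gt0 a m : 0 < reference_mass a m.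
Proof.
apply: mulr_gt0; first exact/exprn_gt0/insertion_factor_gt0.
by rewrite -iterD; apply: mass_iter_start_gt0.
Qed.

Lemma kdesc_count_near m (I : {set 'I_m.+1}) :
    (0 < #|I|)%N ->
    (forall i, i \in I -> G < i /\ i + d + G.+2 <= m.+1)%N ->
    (forall i i', i \in I -> i' \in I -> (i < i')%N -> i + G.+2 <= i')%N ->
  exists2 M, (kdesc_count d.+1 I)%:R = m.+1`!%:R * M &
    M <= q ^+ (3 * #|I|) * reference_mass #|I| m /\
    reference_mass #|I| m <= q ^+ (3 * #|I|) * M.
Proof.
move=> I0 hI gap; pose b := forced_times d.+1 I.
pose s := sort geq [seq (i + d)%N | i : 'I_m.+1 <- enum I].
have bE x : b x = (x \in s).
  rewrite mem_sort; apply/existsP/mapP => [[i /andP[iI /eqP<-]]|[i iI ->]].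
    by exists i; rewrite ?mem_enum.
  by exists i; rewrite -mem_enum iI /=.
have memP x : x \in s -> exists2 i : 'I_m.+1, i \in I & x = (i + d)%N.
  by rewrite mem_sort => /mapP[i]; rewrite mem_enum; exists i.
have sizes : size s = #|I| by rewrite size_sort size_map -cardE.
have us : uniq s.
  by rewrite sort_uniq map_inj_uniq ?enum_uniq// => i i' /addIn /val_inj.
have Gm : (G <= m)%N by case/card_gt0P: I0 => i /hI; lia.
have bm : b m = false by rewrite bE; apply/negP => /memP[i /hI] + e; lia.
have path_s : path spaced m.+1 s.
  rewrite path_min_sorted; last by apply/allP => x /memP[i /hI] + ->; rewrite /spaced; lia.
  have: sorted gtn s.
    by rewrite gtn_sorted_uniq_geq us sort_sorted// => x y; apply: leq_total.
  apply: (@sub_in_sorted _ [in s] gtn); last by apply/allP => x.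
  move=> x y /memP[i iI ->] /memP[i' iI' ->] /=; rewrite /spaced ltn_add2r => ii'.
  by have := gap _ _ iI' iI ii'; lia.
have := @state_density_near b s m Gm (fun x _ => bE x) _ path_s.
have all_s : all (ltn G) s by apply/allP => x /memP[i /hI] + ->; rewrite /=; lia.
move=> /(_ all_s)/(cone_form_near (mass_form R d)).
rewrite (cone_formZ _ _ (mass_form R d)) sizes => nearM.
exists (mass d (state_density R d.+1 b m)) => //.
rewrite -count_admissible//; congr (_%:R).
rewrite /kdesc_count; congr #|pred_of_set _|; apply/setP => w; rewrite !inE.
by apply: kdesc_admissible => // i /hI; lia.
Qed.

End InsertedRuns.

(** * The rate of convergence *)

Lemma bernoulli_decay (R : realFieldType) (delta : R) n :
  0 <= delta <= 1 -> (1 - delta) ^+ n * (1 + n%:R * delta) <= 1.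
Proof.
move=> /andP[d0 d1]; elim: n => [|n IH]; first by rewrite expr0 mul0r addr0 mulr1.
apply: le_trans IH; rewrite exprSr -mulrA; apply: ler_wpM2l.
  by rewrite exprn_ge0// subr_ge0.
rewrite -natr1; have : 0 <= n%:R * delta ^+ 2 by rewrite mulr_ge0// sqr_ge0.
nra.
Qed.

(** A linear bound for the error that is valid on the whole range of x, so that
    no smallness of x has to be arranged. *)
Lemma expr1D_le (R : realFieldType) (x D : R) n :
  0 <= x <= D -> (1 + x) ^+ n <= 1 + (2 + D) ^+ n * x.
Proof.
move=> /andP[x0 xD]; elim: n => [|n IH]; first by rewrite !expr0 mul1r lerDl.
have c1 : 1 <= (2 + D) ^+ n by apply: exprn_ege1; lra.
rewrite exprSr [in leRHS]exprSr; move: IH c1.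
move: (_ ^+ n) => A; move: ((2 + D) ^+ n) => c IH c1.
apply: (@le_trans _ _ ((1 + c * x) * (1 + x))).
  by apply: ler_wpM2r => //; lra.
have : c * x * x <= c * x * D by apply: ler_wpM2l => //; rewrite mulr_ge0//; lra.
have : x <= c * x by rewrite ler_peMl.
nra.
Qed.

Lemma ratio_near (R : realFieldType) (Q M1 M2 X : R) : 1 <= Q -> 0 < X ->
    M1 <= Q * X -> X <= Q * M1 -> M2 <= Q * X -> X <= Q * M2 ->
  0 < M2 /\ `|M1 / M2 - 1| <= Q ^+ 2 - 1.
Proof.
move=> Q1 X0 h1 h2 h3 h4.
have M2p : 0 < M2 by rewrite -(pmulr_rgt0 _ (lt_le_trans ltr01 Q1)) (lt_le_trans X0).
split => //; rewrite ler_norml; apply/andP; split; last first.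
  rewrite lerD2r ler_pdivrMr// expr2 -mulrA; apply: le_trans h1 _.
  by apply: ler_wpM2l => //; lra.
have Q2 : 1 <= Q ^+ 2 by apply: exprn_ege1.
suff : 2 - Q ^+ 2 <= M1 / M2 by lra.
rewrite ler_pdivlMr//.
have M21 : M2 <= Q ^+ 2 * M1.
  by rewrite expr2 -mulrA; apply: le_trans h3 _; apply: ler_wpM2l => //; lra.
suff : (2 - Q ^+ 2) * Q ^+ 2 * M1 <= M1.
  move=> h; rewrite -(ler_pM2r (_ : 0 < Q ^+ 2)); last by lra.
  case: (leP (2 - Q ^+ 2) 0) => hq; first nra.
  nra.
have M10 : 0 <= M1 by have : 0 < Q * M1 := lt_le_trans X0 h2; nra.
rewrite -[leRHS]mul1r; apply: ler_wpM2r => //.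
have : 0 <= (Q ^+ 2 - 1) ^+ 2 by apply: sqr_ge0.
nra.
Qed.

Lemma sqrt_far_nat (R : realType) n r x y : (r%:R : R) <= Num.sqrt n%:R ->
  sqrt_far R n x y -> (x <= y)%N -> (x + r <= y)%N.
Proof.
move=> rn far xy; move: (le_trans rn far).
by rewrite distrC -natrB// normr_nat ler_nat; lia.
Qed.

Lemma sqrt_separated_room (R : realType) d m G r (I : {set 'I_m.+1}) :
    (r%:R : R) <= Num.sqrt m.+1%:R -> (1 < d)%N -> (G + d.+1 <= r)%N ->
    sqrt_separated R I ->
  (forall i, i \in I -> G < i /\ i + d + G.+2 <= m.+1)%N /\
  (forall i i', i \in I -> i' \in I -> (i < i')%N -> i + G.+2 <= i')%N.
Proof.
move=> rn d2 Gr [sepI endI]; split=> [i iI|i i' iI i'I ii'].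
  have [far1 farn] := endI i iI.
  have h1 : (1 + r <= pos i)%N.
    by apply: (sqrt_far_nat rn) => //; rewrite /sqrt_far distrC.
  have h2 : (pos i + r <= m.+1)%N by apply: (sqrt_far_nat rn) => //; rewrite /pos.
  by move: h1 h2; rewrite /pos; lia.
have ne : i != i' by apply: contraTneq ii' => ->; rewrite ltnn.
have : (pos i + r <= pos i')%N.
  by apply: (sqrt_far_nat rn (sepI i i' iI i'I ne)); rewrite /pos; lia.
by rewrite /pos; lia.
Qed.

(** The exponential decay, weakened to order 1/j, which is enough because
    j has the order of the square root of n. *)
Lemma mixing_error_decay (R : realFieldType) (C : R) j : 1 <= C ->
  C ^+ 2 * (1 - C^-1) ^+ j * j%:R <= C ^+ 3.
Proof.
move=> C1; have C0 : 0 < C by lra.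
have V0 : 0 <= C^-1 <= 1 by rewrite invr_ge0 ltW//= invf_le1.
have := bernoulli_decay j V0; rewrite mulrDr mulr1 => h.
have th0 : 0 <= (1 - C^-1) ^+ j by apply: exprn_ge0; lra.
have {}h : (1 - C^-1) ^+ j * (j%:R / C) <= 1 by lra.
rewrite -mulrA [C ^+ 3]exprSr; apply: ler_wpM2l; first exact: sqr_ge0.
by rewrite -[leRHS]mul1r -ler_pdivrMr// -mulrA.
Qed.

Lemma inv_sqrt_le_powR (R : realType) n : (0 < n)%N ->
  (Num.sqrt (n%:R : R))^-1 <= n%:R `^ (- (1 / 6)).
Proof.
move=> n0; have n1 : 1 <= n%:R :> R by rewrite ler1n.
rewrite powRN lef_pV2 ?posrE ?powR_gt0 ?sqrtr_gt0 ?ltr0n//.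
by rewrite -powR12_sqrt ?ler0n//; apply: ler_powR => //; lra.
Qed.

(** With j + 1 blocks of p steps in G, the square root of n, which is below
    G + c + 1, is at most a constant times j. *)
Lemma lt_block G p c j : (0 < j)%N -> (G < j.+2 * p)%N ->
  (G + c < j * (3 * p + c.+1))%N.
Proof.
move=> j0; have h1 : (p <= j * p)%N by rewrite leq_pmull.
have h2 : (c.+1 <= j * c.+1)%N by rewrite leq_pmull.
rewrite mulnDr mulnCA !mulSn.
by move: (j * p)%N (j * c.+1)%N h1 h2 => u v; lia.
Qed.

Theorem theorem7p5 (R : realType) (k a : nat) (hk : (3 <= k)%N) (ha : (0 < a)%N) :
  exists (K : R) (N : nat), forall n : nat, (0 < n)%N -> (N <= n)%N ->
    forall I1 I2 : {set 'I_n},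
      #|I1| = a -> #|I2| = a ->
      sqrt_separated R I1 -> sqrt_separated R I2 ->
      kdesc_count k I2 <> 0%N /\
      `|(kdesc_count k I1)%:R / (kdesc_count k I2)%:R - 1|
        <= K * (n%:R `^ (- (1 / 6))).
Proof.
case: k hk => // d d2; pose p := (d + 5)%N; pose C : R := step_distortion R d.
have C1 : 1 <= C by apply: step_distortion_ge1.
pose B := (3 * p + d.+2)%N.
exists ((2 + C ^+ 2) ^+ (6 * a) * (C ^+ 3 * B%:R)), ((d.+1 + 2 * p) ^ 2)%N.
case=> // m _ Nm I1 I2 cI1 cI2 sep1 sep2.
(* Gaps of r leave G mixing steps once the k positions of a run are removed. *)
pose r := Num.truncn (Num.sqrt (m.+1%:R : R)).
have /andP[rn nr] := truncn_itv (sqrtr_ge0 (m.+1%:R : R)).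
have rbig : (d.+1 + 2 * p <= r)%N.
  rewrite truncn_ge_nat ?sqrtr_ge0// -(ler_pXn2r (_ : 0 < 2)%N) ?nnegrE ?sqrtr_ge0 ?ler0n//.
  by rewrite sqr_sqrtr ?ler0n// -natrX ler_nat.
pose G := (r - d.+1)%N; pose j := (G %/ p).-1.
have p0 : (0 < p)%N by rewrite /p; lia.
have Gp : (2 <= G %/ p)%N by rewrite leq_divRL// /G; lia.
have jE : (j.+1 = G %/ p)%N by rewrite prednK//; lia.
have jG : (j.+1 * (d + 5) <= G)%N by rewrite jE leq_trunc_div.
have j1 : (1 <= j)%N by lia.
have Gr : (G + d.+1 <= r)%N by rewrite /G; lia.
have room (I : {set 'I_m.+1}) : #|I| = a -> sqrt_separated R I ->
    exists2 M : R, (kdesc_count d.+1 I)%:R = m.+1`!%:R * M &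
    M <= mixing_error C j ^+ (3 * a) * reference_mass R d G a m /\
    reference_mass R d G a m <= mixing_error C j ^+ (3 * a) * M.
  move=> cI sepI; have [h1 h2] := sqrt_separated_room rn d2 Gr sepI.
  by have := kdesc_count_near R d2 jG _ h1 h2; rewrite cI => /(_ ha).
have [M1 -> [u1 l1]] := room I1 cI1 sep1.
have [M2 E2 [u2 l2]] := room I2 cI2 sep2.
have q1 : 1 <= mixing_error C j by apply: mixing_error_ge1.
have [M20 bound] := ratio_near (exprn_ege1 (3 * a) q1)
  (reference_mass_gt0 R d2 jG a m) u1 l1 u2 l2.
have fact0 : 0 < m.+1`!%:R :> R by rewrite ltr0n fact_gt0.
split.
  by move=> cz; have := mulr_gt0 fact0 M20; rewrite -E2 cz ltxx.
rewrite E2 -mulf_div divff ?gt_eqF// mul1r; apply: le_trans bound _.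
(* The unknown main term cancels; both counts contribute an error q ^ (3 a). *)
rewrite -exprM (_ : 3 * a * 2 = 6 * a)%N; last by lia.
pose x := C ^+ 2 * (1 - C^-1) ^+ j.
have th0 : 0 <= 1 - C^-1 by rewrite subr_ge0 invf_le1//; lra.
have x0 : 0 <= x by rewrite mulr_ge0 ?sqr_ge0 ?exprn_ge0.
have xC : x <= C ^+ 2.
  rewrite -[leRHS]mulr1; apply: ler_wpM2l; first exact: sqr_ge0.
  by apply: exprn_ile1 => //; rewrite gerBl invr_ge0; lra.
have xb : 0 <= x <= C ^+ 2 by rewrite x0.
have := expr1D_le (6 * a) xb; rewrite -/x -[1 + x]/(mixing_error C j) => h.
rewrite lerBlDl; apply: le_trans h _; rewrite lerD2l -mulrA.
apply: ler_wpM2l; first by apply: exprn_ge0; have := sqr_ge0 C; lra.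
apply: le_trans (ler_wpM2l _ (inv_sqrt_le_powR R (ltn0Sn m))); last first.
  by rewrite mulr_ge0 ?ler0n// exprn_ge0//; lra.
rewrite ler_pdivlMr ?sqrtr_gt0 ?ltr0n//.
have sB : Num.sqrt (m.+1%:R : R) <= j%:R * B%:R.
  apply: le_trans (ltW nr) _; rewrite -natrM ler_nat.
  have hG : (G < j.+2 * p)%N by rewrite jE -ltn_divLR.
  by rewrite -/r -(subnK (leq_trans (leq_addr _ _) rbig)); apply: lt_block.
apply: le_trans (ler_wpM2l x0 sB) _; rewrite mulrA.
by apply: ler_wpM2r; [rewrite ler0n | exact: mixing_error_decay].
Qed.
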